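(* Consider the first-order symmetry algebras $\hat{\mathscr{G}}_{n,m}$ of the Klein--Gordon equation on 3-dimensional de Sitter space $\mathrm{dS}_3$ in electromagnetic fields invariant under the inequivalent subalgebras $\mathscr{G}_{n,m}\subset\mathfrak{so}(1,3)$ ($n=\dim\mathscr{G}_{n,m}$). They have basis $\hat X_0,\dots,\hat X_n$ with $\hat X_0$ central and the following nonzero brackets ($\mu$ an arbitrary constant, $a>0$): - $\hat{\mathscr{G}}_{1,1},\hat{\mathscr{G}}_{1,2},\hat{\mathscr{G}}_{1,3}^a,\hat{\mathscr{G}}_{1,4}$: none; - $\hat{\mathscr{G}}_{2,1},\hat{\mathscr{G}}_{2,2}$: $[\hat X_1,\hat X_2]=\mu\hat X_0$; - $\hat{\mathscr{G}}_{2,3}$: $[\hat X_1,\hat X_2]=-\hat X_1$; - $\hat{\mathscr{G}}_{3,1}$: $[\hat X_1,\hat X_3]=-\hat X_1$, $[\hat X_2,\hat X_3]=-\hat X_2$; - $\hat{\mathscr{G}}_{3,2}$: $[\hat X_1,\hat X_2]=\mu\hat X_0$, $[\hat X_1,\hat X_3]=\hat X_2$, $[\hat X_2,\hat X_3]=-\hat X_1$; - $\hat{\mathscr{G}}_{3,3}^a$: $[\hat X_1,\hat X_3]=\hat X_2-a\hat X_1$, $[\hat X_2,\hat X_3]=-\hat X_1-a\hat X_2$; - $\hat{\mathscr{G}}_{3,4}$: $[\hat X_1,\hat X_2]=\hat X_3$, $[\hat X_2,\hat X_3]=\hat X_1$, $[\hat X_3,\hat X_1]=\hat X_2$; - $\hat{\mathscr{G}}_{3,5}$: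 $[\hat X_1,\hat X_2]=\hat X_3$, $[\hat X_1,\hat X_3]=\hat X_2$, $[\hat X_2,\hat X_3]=\hat X_1$; - $\hat{\mathscr{G}}_{4,1}$: $[\hat X_1,\hat X_3]=\hat X_2$, $[\hat X_1,\hat X_4]=-\hat X_1$, $[\hat X_2,\hat X_3]=-\hat X_1$, $[\hat X_2,\hat X_4]=-\hat X_2$. Then the dimension and index of $\hat{\mathscr{G}}$, the numbers $s$, $l$, $\tilde m$ of variables $\lambda$, $J$, $v$ in the noncommutative integration method, and the validity of the noncommutative integrability condition $$\dim\hat{\mathscr{G}}+\operatorname{ind}\hat{\mathscr{G}}\ \ge\ 2\dim\mathrm{dS}_3=6$$ are as follows: - $\hat{\mathscr{G}}_{1,1},\hat{\mathscr{G}}_{1,2},\hat{\mathscr{G}}_{1,3}^a,\hat{\mathscr{G}}_{1,4}$: $\dim=2$, $\operatorname{ind}=2$, $s=0$, $l=1$, $\tilde m=2$; the condition fails; - $\hat{\mathscr{G}}_{2,1},\hat{\mathscr{G}}_{2,2},\hat{\mathscr{G}}_{2,3}$: $\dim=3$, $\operatorname{ind}=1$, $s=1$, $l=0$, $\tilde m=2$; the condition fails; - $\hat{\mathscr{G}}_{3,1},\hat{\mathscr{G}}_{3,2},\hat{\mathscr{G}}_{3,3}^a,\hat{\mathscr{G}}_{3,4},\hat{\mathscr{G}}_{3,5}$: $\dim=4$, $\operatorname{ind}=2$, $s=1$, $l=1$, $\tilde m=1$; the condition holds; - $\hat{\mathscr{G}}_{4,1}$: $\dim=5$, $\operatorname{ind}=3$,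 $s=1$, $l=2$, $\tilde m=0$; the condition holds. Thus the Klein--Gordon equation on $\mathrm{dS}_3$ is integrable only for electromagnetic fields invariant under three- and four-dimensional subalgebras of $\mathfrak{so}(1,3)$.
   Context: $\mathrm{dS}_3$ is the one-sheeted hyperboloid $x_0^2-x_1^2-x_2^2-x_3^2=-1$ in Minkowski space $\mathbb R^{1,3}$; $\mathfrak{so}(1,3)$ is its algebra of Killing vectors. The Klein--Gordon equation is $(g^{ab}D_aD_b+\zeta R+m^2)\varphi=0$ with $D_a=\nabla_a-ie\mathscr{A}_a$. If $\hat{\mathscr{G}}$ has brackets $[\hat X_A,\hat X_B]=C_{AB}^C\hat X_C+\mathbf F_{AB}\hat X_0$, its index is $\operatorname{ind}\hat{\mathscr{G}}=\dim\hat{\mathscr{G}}-\sup_{f\in\hat{\mathscr{G}}^*}\operatorname{rank}\|C_{AB}^Cf_C+\mathbf F_{AB}f_0\|$. Noncommutative integration uses an operator-irreducible representation ($\lambda$-representation) of $\hat{\mathscr{G}}$ by first-order operators $\hat\ell_A$ in $s=(\dim\hat{\mathscr{G}}-\operatorname{ind}\hat{\mathscr{G}})/2$ variables $\lambda$, depending on $l=\operatorname{ind}\hat{\mathscr{G}}-1$ real parameters $J$; solving the system $\hat X_A\varphi=-\hat\ell_A\varphi$ reduces the Klein--Gordon equation to an equation in $\tilde m=\dim\mathrm{dS}_3-\frac12(\dim\hat{\mathscr{G}}+\operatorname{ind}\hat{\mathscr{G}})+1$ variables $v$. The equation is called integrable if the construction of a basis of its solutions can be reduced to solving an ordinary differential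 equation (or an algebraic one); integrable cases are selected by the displayed condition, which is equivalent to $\tilde m\le1$.
   Formalization: The row for the 4,1 algebra is corrected: its listed brackets give ind=1, s=2, l=0, m̃=1 (not 3, 1, 2, 0), since the generic rank is 4. For the 2,1 and 2,2 algebras μ≠0 is assumed, because μ=0 gives an abelian algebra with ind=3, for which the condition holds. *)

(* Defs.v *)
From mathcomp Require Import all_boot all_order all_algebra.
From mathcomp Require Import classical_sets reals.

Set Implicit Arguments.
Unset Strict Implicit.
Unset Printing Implicit Defensive.

Import Order.TTheory GRing.Theory Num.Theory.

Local Open Scope ring_scope.

(* Points and tangent vectors of R^{1,3} are row vectors. *)
Definition eta (R : realType) : 'M[R]_4 :=
  diag_mx (\row_(i < 4) (if i == ord0 then 1 else -1)).

Definition dS3 (R : realType) : set 'rV[R]_4 :=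
  [set x | (x *m eta R *m x^T) 0 0 = -1]%classic.

Definition dS3_tangent (R : realType) (x : 'rV[R]_4) : 'M[R]_4 :=
  kermx (eta R *m x^T).

Definition dim_dS3 : nat := 3.

Lemma dim_dS3E (R : realType) (x : 'rV[R]_4) :
  dS3 x -> \rank (dS3_tangent x) = dim_dS3.
Proof.
rewrite /dS3 /dS3_tangent /= => hx; rewrite mxrank_ker.
have u0 : eta R *m x^T != 0.
  apply/eqP => e; move: hx; rewrite -mulmxA e mulmx0 mxE => /esym/eqP.
  by rewrite oppr_eq0 oner_eq0.
suff -> : \rank (eta R *m x^T) = 1%N by [].
by apply/eqP; rewrite eqn_leq rank_leq_col lt0n mxrank_eq0.
Qed.

(* The matrix A generates the Killing vector field x |-> x *m A of dS3. *)
Definition so13 (R : realType) (A : 'M[R]_4) : Prop :=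
  A *m eta R + eta R *m A^T = 0.

Definition so13_subalgebra (R : realType) (G : {vspace 'M[R]_4}) : Prop :=
  (forall A, A \in G -> so13 A) /\
  (forall A B, A \in G -> B \in G -> A *m B - B *m A \in G).

Record lie_bracket (R : realType) (L : vectType R) (br : L -> L -> L) : Prop :=
  LieBracket {
    lie_linear_l : forall z, linear (fun x => br x z);
    lie_linear_r : forall z, linear (br z);
    lie_alternating : forall x, br x x = 0;
    lie_jacobi : forall x y z,
      br x (br y z) + br y (br z x) + br z (br x y) = 0 }.

(* pi sends a first-order symmetry operator to its Killing vector field; its
   kernel consists of the multiples of the charge operator X0. *)
Definition field_extension (R : realType) (L : vectType R)
    (br : L -> L -> L) (X0 : L) (G : {vspace 'M[R]_4})
    (pi : 'Hom(L, 'M[R]_4)) : Prop :=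
  [/\ forall x y, pi (br x y) = pi x *m pi y - pi y *m pi x,
      limg pi = G & lker pi = <[X0]>%VS].

Section Index.
Variables (R : realType) (L : vectType R) (br : L -> L -> L).
Variables (n : nat) (X : n.-tuple L).

Definition structure_constant (A B C : 'I_n) : R :=
  coord X C (br X`_A X`_B).

(* The central element X0 is one of the basis vectors X`_C, so the term
   F_AB f_0 is the summand C = 0. *)
Definition coadjoint_mx (f : 'Hom(L, R^o)) : 'M[R]_n :=
  \matrix_(A, B) \sum_(C < n) structure_constant A B C * f X`_C.

Definition lie_dim : R := (\dim {:L})%:R.

Definition lie_index : R :=
  lie_dim - sup [set (\rank (coadjoint_mx f))%:R | f in [set: 'Hom(L, R^o)]]%classic.

Definition num_lambda : R := (lie_dim - lie_index) / 2.

Definition num_J : R := lie_index - 1.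

Definition num_v : R := dim_dS3%:R - (lie_dim + lie_index) / 2 + 1.

Definition nc_condition : Prop := lie_dim + lie_index >= 2 * dim_dS3%:R.

(* The reduced equation is ordinary or algebraic. *)
Definition nc_integrable : Prop := num_v <= 1.

Lemma nc_conditionE : nc_condition <-> nc_integrable.
Proof.
rewrite /nc_condition /nc_integrable /num_v -lerBrDr subrr subr_le0.
by rewrite ler_pdivlMr ?ltr0n // mulrC.
Qed.

End Index.

(* The inequivalent types of symmetry algebras with their parameters. *)
Inductive symmetry_type (R : realType) : Type :=
  | G11 | G12 | G13 of R | G14
  | G21 of R | G22 of R | G23
  | G31 | G32 of R | G33 of R | G34 | G35
  | G41.

Arguments G11 {R}.
Arguments G12 {R}.
Arguments G14 {R}.
Arguments G23 {R}.
Arguments G31 {R}.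
Arguments G34 {R}.
Arguments G35 {R}.
Arguments G41 {R}.

Definition killing_dim (R : realType) (t : symmetry_type R) : nat :=
  match t with
  | G11 | G12 | G13 _ | G14 => 1
  | G21 _ | G22 _ | G23 => 2
  | G31 | G32 _ | G33 _ | G34 | G35 => 3
  | G41 => 4
  end.

(* For G21 and G22 the bracket mu X0 is a nonzero one: with mu = 0 these
   algebras are abelian, hence of index 3 and not 1.  The index of G32 does not
   depend on mu, which is unrestricted there. *)
Definition admissible (R : realType) (t : symmetry_type R) : Prop :=
  match t with
  | G13 a | G33 a => 0 < a
  | G21 mu | G22 mu => mu != 0
  | _ => True
  end.

(* For G41 the coadjoint matrix restricted to X_1, ..., X_4 has determinant
   (f_1^2 + f_2^2)^2, so its generic rank is 4 and the index is 5 - 4 = 1; the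
   published table gives index 3 here. *)
Definition listed_bracket (R : realType) (L : vectType R)
    (t : symmetry_type R) (X : seq L) (i j : nat) : L :=
  match t, i, j with
  | G21 mu, 1, 2 | G22 mu, 1, 2 => mu *: X`_0
  | G23, 1, 2 => - X`_1
  | G31, 1, 3 => - X`_1
  | G31, 2, 3 => - X`_2
  | G32 mu, 1, 2 => mu *: X`_0
  | G32 _, 1, 3 => X`_2
  | G32 _, 2, 3 => - X`_1
  | G33 a, 1, 3 => X`_2 - a *: X`_1
  | G33 a, 2, 3 => - X`_1 - a *: X`_2
  | G34, 1, 2 => X`_3
  | G34, 2, 3 => X`_1
  | G34, 3, 1 => X`_2
  | G35, 1, 2 => X`_3
  | G35, 1, 3 => X`_2
  | G35, 2, 3 => X`_1
  | G41, 1, 3 => X`_2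
  | G41, 1, 4 => - X`_1
  | G41, 2, 3 => - X`_1
  | G41, 2, 4 => - X`_2
  | _, _, _ => 0
  end.

(* At most one of the pairs (i, j) and (j, i) is listed; the other bracket
   follows by antisymmetry, and unlisted brackets vanish. *)
Definition has_brackets (R : realType) (L : vectType R) (br : L -> L -> L)
    (t : symmetry_type R) (X : (killing_dim t).+1.-tuple L) : Prop :=
  forall i j : 'I_(killing_dim t).+1,
    br X`_i X`_j = listed_bracket t X i j - listed_bracket t X j i.

(* Main.v *)
Require Import Defs.
From mathcomp Require Import all_boot all_order all_algebra.
From mathcomp Require Import classical_sets reals.
From mathcomp Require Import lra.
Import Order.TTheory GRing.Theory Num.Theory.
Local Open Scope ring_scope.

(* The coadjoint matrix is skew-symmetric, and its row and column of index 0
   vanish since X_0 is central.  Hence its rank is that of a skew-symmetric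
   matrix of size n = dim G_(n,m), which is at most n - 1 for odd n and at most n
   for even n.  Evaluating at a functional of the dual basis shows that these
   bounds are attained for every listed algebra with admissible parameters, so
   that the index is 2 for odd n and 1 for even n. *)

Lemma rank_mxsub_le {F : fieldType} {m n p q : nat} (f : 'I_p -> 'I_m)
    (g : 'I_q -> 'I_n) (A : 'M[F]_(m, n)) : (\rank (mxsub f g A) <= \rank A)%N.
Proof.
have rank_rowsub (m' n' p' : nat) (h : 'I_p' -> 'I_m') (B : 'M[F]_(m', n')) :
    (\rank (rowsub h B) <= \rank B)%N.
  by rewrite mxrankS ?rowsub_sub.
rewrite mxsubrc (leq_trans (rank_rowsub _ _ _ _ _)) //.
by rewrite -mxrank_tr trmx_mxsub -[leqRHS]mxrank_tr.
Qed.

(** The selected minor is lower triangular with nonzero diagonal, hence invertible. Rows and columns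
    are chosen by separate maps so that blocks which become triangular only after a permutation of
    columns are covered. *)
Lemma rank_ge_trig {F : fieldType} {m n p : nat} (f : 'I_p -> 'I_m)
    (g : 'I_p -> 'I_n) (A : 'M[F]_(m, n)) :
  (forall i j : 'I_p, (i < j)%N -> A (f i) (g j) = 0) ->
  (forall i, A (f i) (g i) != 0) -> (p <= \rank A)%N.
Proof.
move=> trigA diagA; rewrite -(@mxrank_unit _ _ (mxsub f g A)) ?rank_mxsub_le //.
rewrite unitmxE det_trig ?unitfE; last first.
  by apply/is_trig_mxP => i j ij; rewrite mxE trigA.
by apply/prodf_neq0 => i _; rewrite mxE.
Qed.

Section SkewMatrix.
Context {R : realType}.

Lemma skew_entry {n : nat} {A : 'M[R]_n} :
  A^T = - A -> forall i j, A j i = - A i j.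
Proof. by move=> skA i j; have := congr1 (fun B : 'M_n => B i j) skA; rewrite !mxE. Qed.

(** Transposition preserves the determinant while negation multiplies it by (-1)^n = -1, and 2 is
    invertible in [R]. *)
Lemma det_skew_odd {n : nat} {A : 'M[R]_n} : A^T = - A -> odd n -> \det A = 0.
Proof.
move=> skA n_odd; have : \det A = - \det A.
  by rewrite -[LHS]det_tr skA -scaleN1r detZ -signr_odd n_odd mulN1r.
by move=> h; lra.
Qed.

Lemma rank_skew_le {n : nat} {A : 'M[R]_n} :
  A^T = - A -> (\rank A <= n - odd n)%N.
Proof.
move=> skA; case: (boolP (odd n)) => [n_odd|_]; last by rewrite subn0 rank_leq_row.
have : A \notin unitmx by rewrite unitmxE det_skew_odd // unitr0.
rewrite -row_free_unit /row_free => neq_n; rewrite subn1 -ltnS.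
by rewrite prednK ?odd_gt0 // ltn_neqAle neq_n rank_leq_row.
Qed.

Lemma rank_skew_ge2 {n : nat} {A : 'M[R]_n} {i j : 'I_n} :
  A^T = - A -> A i j != 0 -> (2 <= \rank A)%N.
Proof.
move=> skA Aij; have diag0 k : A k k = 0 by have := skew_entry skA k k; lra.
(* The minor on rows i, j and columns j, i is diagonal with entries [A i j] and [A j i], since [A]
   has zero diagonal. *)
apply: (@rank_ge_trig _ _ _ 2 (fun k => if k == 0 then i else j)
  (fun k => if k == 0 then j else i)) => [[[|[|//]] ?] [[|[|//]] ?]|[[|[|//]] ?]] //=.
by rewrite (skew_entry skA) oppr_eq0.
Qed.

(** By skewness the first column vanishes too, so only the skew block of size [n] contributes to the
    rank. *)
Lemma rank_skew_border0 {n : nat} {A : 'M[R]_(1 + n)} :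
  A^T = - A -> row 0 A = 0 -> (\rank A <= n - odd n)%N.
Proof.
move=> skA A0.
have A0j j : A 0 j = 0 by have /matrixP/(_ 0 j) := A0; rewrite !mxE.
have -> : A = block_mx 0 0 0 (drsubmx A).
  rewrite -[LHS]submxK; congr block_mx; apply/matrixP => i j; rewrite !mxE ord1 lshift0.
  - exact: A0j.
  - exact: A0j.
  - by rewrite (skew_entry skA) A0j oppr0.
rewrite (@rank_diag_block_mx _ 1 1) mxrank0; apply: rank_skew_le.
by rewrite trmx_drsub skA; apply/matrixP => i j; rewrite !mxE.
Qed.

End SkewMatrix.

Lemma sup_max {R : realType} {E : set R} {r : R} :
  E r -> ubound E r -> sup E = r.
Proof.
move=> Er Ur; apply/eqP; rewrite eq_le ge_sup //; last by exists r.
by rewrite ub_le_sup //; exists r.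
Qed.

Section CoadjointMatrix.
Context {R : realType} {L : vectType R} {br : L -> L -> L}.

(** Summing the structure constants against [f] recovers the Kirillov form (x, y) -> f [x, y] on
    basis vectors. *)
Lemma coadjoint_mxE {n : nat} {X : n.-tuple L} (f : 'Hom(L, R^o)) A B :
  basis_of {:L} X -> coadjoint_mx br X f A B = f (br X`_A X`_B).
Proof.
move=> bX; rewrite mxE [X in _ = f X](coord_basis bX (memvf _)) linear_sum.
by apply: eq_bigr => C _; rewrite linearZ.
Qed.

Lemma lie_indexE {n r : nat} {X : n.-tuple L} :
  (forall f, (\rank (coadjoint_mx br X f) <= r)%N) ->
  (exists f, (r <= \rank (coadjoint_mx br X f))%N) ->
  lie_index br X = lie_dim L - r%:R.
Proof.
move=> le_r [f ge_r]; congr (_ - _); apply: sup_max => [|_ [g _ <-]].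
  by exists f => //; congr (_%:R); apply/eqP; rewrite eqn_leq le_r.
by rewrite ler_nat.
Qed.

Lemma dual_basis {n : nat} {X : n.-tuple L} (k : nat) :
  basis_of {:L} X ->
  exists f : 'Hom(L, R^o), forall j : nat, (j < n)%N -> f X`_j = (j == k)%:R.
Proof.
move=> bX; case: (ltnP k n) => [kn|nk]; last first.
  (* An out-of-range [k] gets the zero functional, so that the functionals for k = 0, ..., 3 are
     available before the case split on [t], whatever the dimension. *)
  exists 0 => j jn; rewrite lfunE /=; case: eqP => // ejk.
  by rewrite ejk ltnNge nk in jn.
exists (linfun (coord X (Ordinal kn) : L -> R^o)) => j jn.
by rewrite lfunE /= (coord_free (Ordinal jn) _ (basis_free bX)).
Qed.

Context {t : symmetry_type R} {X : (killing_dim t).+1.-tuple L}.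
Hypotheses (bX : basis_of {:L} X) (hX : has_brackets br X).

Lemma coadjoint_listed f i j : coadjoint_mx br X f i j =
  f (listed_bracket t X i j) - f (listed_bracket t X j i).
Proof. by rewrite coadjoint_mxE // hX linearB. Qed.

Lemma coadjoint_skew f : (coadjoint_mx br X f)^T = - coadjoint_mx br X f.
Proof. by apply/matrixP => i j; rewrite mxE [RHS]mxE !coadjoint_listed opprB. Qed.

Lemma coadjoint_row0 f : row 0 (coadjoint_mx br X f) = 0.
Proof.
have l0 s (Y : seq L) j : listed_bracket s Y 0 j = 0 by case: s.
have r0 s (Y : seq L) i : listed_bracket s Y i 0 = 0.
  by case: s => [||a||mu|mu|||mu|a|||]; case: i => [|[|[|[|i]]]].
by apply/rowP => j; rewrite [LHS]mxE [RHS]mxE coadjoint_listed l0 r0 subrr.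
Qed.

Lemma rank_coadjoint_le f :
  (\rank (coadjoint_mx br X f) <= killing_dim t - odd (killing_dim t))%N.
Proof. exact: rank_skew_border0 (coadjoint_skew f) (coadjoint_row0 f). Qed.

End CoadjointMatrix.

Lemma rank_coadjoint_ge {R : realType} {L : vectType R} {br : L -> L -> L}
    {t : symmetry_type R} {X : (killing_dim t).+1.-tuple L} :
  admissible t -> basis_of {:L} X -> has_brackets br X ->
  exists f, (killing_dim t - odd (killing_dim t) <= \rank (coadjoint_mx br X f))%N.
Proof.
move=> adm bX hX.
have [f0 f0E] := dual_basis 0 bX; have [f1 f1E] := dual_basis 1 bX.
have [f2 f2E] := dual_basis 2 bX; have [f3 f3E] := dual_basis 3 bX.
(* Except for [G41] the required rank is 0 or 2, so at most one pair of basis vectors with [f]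
   nonzero on its bracket is needed. *)
have ge2 (f : 'Hom(L, R^o)) (i j : nat)
    (lti : (i < (killing_dim t).+1)%N) (ltj : (j < (killing_dim t).+1)%N) :
    f (listed_bracket t X i j) - f (listed_bracket t X j i) != 0 ->
    (2 <= \rank (coadjoint_mx br X f))%N.
  move=> nz; apply: (rank_skew_ge2 (i := Ordinal lti) (j := Ordinal ltj)).
    exact: coadjoint_skew.
  by rewrite coadjoint_listed.
case: t X adm bX hX f0E f1E f2E f3E ge2 => /=
  [||a||mu|mu|||mu|a|||] X adm bX hX f0E f1E f2E f3E ge2;
  rewrite ?subnn ?subn0 ?subn1 /=; try by exists 0.
(* On [X_1, X_2] = mu X_0 the functional dual to X_0 takes the value mu, nonzero by
   admissibility. *)
- exists f0; apply: (ge2 _ 1 2) => //=; rewrite linear0 linearZ /= f0E //= subr0.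
  by rewrite scaler_eq0 negb_or adm oner_eq0.
- exists f0; apply: (ge2 _ 1 2) => //=; rewrite linear0 linearZ /= f0E //= subr0.
  by rewrite scaler_eq0 negb_or adm oner_eq0.
- exists f1; apply: (ge2 _ 1 2) => //=.
  by rewrite linear0 linearN /= f1E //= subr0 oppr_eq0 oner_eq0.
- exists f1; apply: (ge2 _ 1 3) => //=.
  by rewrite linear0 linearN /= f1E //= subr0 oppr_eq0 oner_eq0.
(* For [G32] the bracket [X_1, X_3] = X_2 is taken instead of [X_1, X_2] = mu X_0, because mu may
   vanish here. *)
- exists f2; apply: (ge2 _ 1 3) => //=.
  by rewrite linear0 f2E //= subr0 oner_eq0.
- exists f1; apply: (ge2 _ 2 3) => //=.
  rewrite linear0 linearB linearN linearZ /= !f1E //=.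
  by rewrite scaler0 !subr0 oppr_eq0 oner_eq0.
- exists f3; apply: (ge2 _ 1 2) => //=.
  by rewrite linear0 f3E //= subr0 oner_eq0.
- exists f3; apply: (ge2 _ 1 2) => //=.
  by rewrite linear0 f3E //= subr0 oner_eq0.
(* For f dual to X_1 only the entries (1, 4), (2, 3) and their mirror images
   survive, so reversing the order of the columns 1, ..., 4 gives a diagonal
   block. *)
exists f1; apply: (rank_ge_trig (fun k : 'I_4 => lift 0 k)
  (fun k : 'I_4 => lift 0 (rev_ord k))) => [i j|i];
  rewrite (coadjoint_listed (t := G41) bX hX).
  case: i j => [[|[|[|[|//]]]] ?] [[|[|[|[|//]]]] ?] //= _;
  by rewrite ?linearN linear0 /= ?f1E //= ?oppr0 addr0.
case: i => [[|[|[|[|//]]]] ?] /=;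
by rewrite linearN linear0 /= f1E //= ?opprK ?subr0 ?add0r ?oppr_eq0 oner_eq0.
Qed.

Theorem mainTheorem4 (R : realType) (t : symmetry_type R) (L : vectType R)
    (br : L -> L -> L) (X : (killing_dim t).+1.-tuple L) :
  admissible t ->
  lie_bracket br ->
  basis_of {:L} X ->
  has_brackets br X ->
  match t with
  | G11 | G12 | G13 _ | G14 =>
      [/\ lie_dim L = 2, lie_index br X = 2 & num_lambda br X = 0] /\
      [/\ num_J br X = 1, num_v br X = 2 & ~ nc_condition br X]
  | G21 _ | G22 _ | G23 =>
      [/\ lie_dim L = 3, lie_index br X = 1 & num_lambda br X = 1] /\
      [/\ num_J br X = 0, num_v br X = 2 & ~ nc_condition br X]
  | G31 | G32 _ | G33 _ | G34 | G35 =>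
      [/\ lie_dim L = 4, lie_index br X = 2 & num_lambda br X = 1] /\
      [/\ num_J br X = 1, num_v br X = 1 & nc_condition br X]
  | G41 =>
      [/\ lie_dim L = 5, lie_index br X = 1 & num_lambda br X = 2] /\
      [/\ num_J br X = 0, num_v br X = 1 & nc_condition br X]
  end /\
  (forall (G : {vspace 'M[R]_4}) (pi : 'Hom(L, 'M[R]_4)),
     so13_subalgebra G ->
     field_extension br X`_0 G pi ->
     nc_integrable br X <-> \dim G = 3%N \/ \dim G = 4%N).
Proof.
move=> adm lie_br bX hX.
have dimL : \dim {:L} = (killing_dim t).+1 := size_basis bX.
have indE : lie_index br X = 1 + (odd (killing_dim t))%:R.
  rewrite (lie_indexE (rank_coadjoint_le bX hX) (rank_coadjoint_ge adm bX hX)).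
  rewrite /lie_dim dimL natrB; last by case: (t).
  by rewrite -natr1; lra.
have numvE : num_v br X =
    3%:R - ((killing_dim t).+1%:R + (1 + (odd (killing_dim t))%:R)) / 2 + 1.
  by rewrite /num_v indE /lie_dim dimL.
split.
  case: t X adm bX hX dimL indE numvE =>
    [||a||mu|mu|||mu|a|||] /= X adm bX hX dimL indE numvE;
  by rewrite /num_lambda /num_J /nc_condition numvE indE /lie_dim dimL /dim_dS3;
  do ![split]; try lra; apply/negP; rewrite -ltNge; lra.
move=> G pi _ [_ <- kerE].
(* This makes the kernel of [pi] a line, so rank-nullity gives [G] the dimension [killing_dim t]. *)
have X0_neq0 : X`_0 != 0.
  by rewrite (free_not0 (basis_free bX)) // mem_nth ?size_tuple.
have dimG : \dim (limg pi) = killing_dim t.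
  have := limg_ker_dim pi fullv; rewrite capfv kerE dim_vline X0_neq0 dimL.
  by case.
(* Only arithmetic remains: the number of variables v is 2 when [killing_dim t] is 1 or 2, and 1
   when it is 3 or 4. *)
rewrite dimG /nc_integrable numvE; clear.
by case: (t) => [||a||mu|mu|||mu|a|||] /=; split=> [h|[]// _];
  first [by left | by right | by exfalso; lra | lra].
Qed.
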